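(* Let $r_1,r_2$ be handshake actions and $t_1,t_2,e$ pairwise distinct output actions. There does not exist a net $N$ (labelled over $Act$) such that, for both $i\in\{1,2\}$: (1) every complete path of $N$ on which $r_i$ occurs only finitely often is $r_i$-enabled; (2) on every complete path of $N$, each occurrence of $r_i$ is followed (later on the path) by an occurrence of $t_i$; (3) on every finite path of $N$ there are no more occurrences of $t_i$ than of $r_i$; and (4) on every path of $N$, between any two occurrences of actions from $\{t_1,t_2\}$ there is an occurrence of $e$.
   Context: $Act=H\uplus O\uplus\{\tau\}$ is a set of actions, where $H$ is a set of handshake actions, $O$ a set of output actions, and $\tau$ the internal action; actions in $O\cup\{\tau\}$ are non-blocking. Multisets over $X$ are functions $X\to\mathbb N$, with $\le$, $+$, $-$ and $\cap$ (pointwise minimum) defined pointwise. A labelled Petri net is $N=(S,T,F,M_0,\ell)$ with disjoint sets $S$ (places) and $T$ (transitions), $F:(S\times T)\cup(T\times S)\to\mathbb N$, initial marking $M_0:S\to\mathbb N$, and $\ell:T\to Act$. For $u\in T$, ${}^\bullet u(s)=F(s,u)$ and $u^\bullet(s)=F(u,s)$. $u$ is enabled at marking $M$ ($M[u\rangle$) if ${}^\bullet u\le M$, and then firing gives $M[u\rangle M'$ with $M'=M-{}^\bullet u+u^\bullet$. A path is an alternating sequence $M_0u_1M_1u_2M_2\dots$ starting at $M_0$, infinite or ending in a marking, with $M_{k}[u_{k+1}\rangle M_{k+1}$ for all relevant $k$; an action $\alpha$ occurs on it if some $\ell(u_i)=\alpha$. A marking is reachable if it occurs on a path. $N$ is a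 structural conflict net if ${}^\bullet u+{}^\bullet v\le M$ implies ${}^\bullet u\cap{}^\bullet v=\emptyset$ for all reachable $M$ and all transitions $u,v$. A net is a structural conflict net in which ${}^\bullet u\neq\emptyset$ for every transition $u$ and all reachable markings are finite. On a path $M_0u_1M_1u_2\dots$, a transition $v$ is continuously enabled from position $k$ onwards if $M_k[v\rangle$ and ${}^\bullet v\cap{}^\bullet u_i=\emptyset$ for all $i>k$; the path is then called $\ell(v)$-enabled. A path is complete (just) if it is $o$-enabled for no $o\in O\cup\{\tau\}$.
   Formalization: The handshake actions r_1 and r_2 are assumed to be distinct; for r_1 = r_2 the claim fails, as the one-token cyclic net r, t_1, e, t_2, e satisfies (1)-(4). *)

(* Defs.v *)
From mathcomp Require Export all_boot.
From mathcomp Require Export boolp classical_sets cardinality.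

Set Implicit Arguments.
Unset Strict Implicit.
Unset Printing Implicit Defensive.

Local Open Scope classical_set_scope.

Inductive act (H O : Type) : Type :=
  | Handshake of H
  | Output of O
  | Tau.
Arguments Handshake {H O} h.
Arguments Output {H O} o.
Arguments Tau {H O}.

Definition nonblocking (H O : Type) (a : act H O) : Prop :=
  if a is Handshake _ then False else True.

(* Multisets need not have finite support. *)
Definition mset (X : Type) : Type := X -> nat.

Section Multisets.
Variable X : Type.
Implicit Types A B : mset X.

Definition mset0 : mset X := fun _ => 0.
Definition mle A B : Prop := forall x, A x <= B x.
Definition madd A B : mset X := fun x => A x + B x.
Definition msub A B : mset X := fun x => A x - B x.
Definition mcap A B : mset X := fun x => minn (A x) (B x).
Definition mfinite A : Prop := finite_set [set x | 0 < A x].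

End Multisets.

(* Places and transitions are separate types, hence disjoint. *)
Record petri (H O : Type) : Type := Petri {
  place : Type;
  trans : Type;
  flow : (place * trans) + (trans * place) -> nat;
  init : mset place;
  label : trans -> act H O
}.
Arguments init {H O} N _ : rename.

(* The part of a path after its initial marking: [(u, M)] at index [k]
   (counted from 0) stands for the transition [u_{k+1}] and the marking
   [M_{k+1}]. *)
Inductive steps (H O : Type) (N : petri H O) : Type :=
  | Fin of seq (trans N * mset (place N))
  | Inf of (nat -> trans N * mset (place N)).
Arguments Fin {H O N}.
Arguments Inf {H O N}.

Section Nets.
Variables (H O : Type) (N : petri H O).
Implicit Types (u v : trans N) (M : mset (place N)) (p : steps N).
Implicit Types (a : act H O) (i k : nat).

Definition pre u : mset (place N) := fun s => flow (inl (s, u)).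
Definition post u : mset (place N) := fun s => flow (inr (u, s)).

Definition enabled M u : Prop := mle (pre u) M.

Definition fires M u M' : Prop :=
  enabled M u /\ M' = madd (msub M (pre u)) (post u).

Definition step_at p k : option (trans N * mset (place N)) :=
  match p with
  | Fin s => onth s k
  | Inf f => Some (f k)
  end.

(* [marking_at p k] is M_k and [trans_at p k] is u_k, when they exist;
   there is no u_0. *)
Definition marking_at p k : option (mset (place N)) :=
  if k is k'.+1 then omap snd (step_at p k') else Some (init N).

Definition trans_at p k : option (trans N) :=
  if k is k'.+1 then omap fst (step_at p k') else None.

Definition is_path p : Prop :=
  forall k u M M', marking_at p k = Some M -> trans_at p k.+1 = Some u ->
    marking_at p k.+1 = Some M' -> fires M u M'.

Definition reachable M : Prop :=
  exists p k, is_path p /\ marking_at p k = Some M.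

Definition structural_conflict : Prop :=
  forall M u v, reachable M -> mle (madd (pre u) (pre v)) M ->
    mcap (pre u) (pre v) = mset0 (X := place N).

Definition is_net : Prop :=
  [/\ structural_conflict,
      forall u, pre u <> mset0 (X := place N)
    & forall M, reachable M -> mfinite M].

Definition occurs_at p a k : Prop :=
  exists2 u, trans_at p k = Some u & label u = a.

Definition occurrences p a : set nat := [set k | occurs_at p a k].

Definition count_occ (s : seq (trans N * mset (place N))) a : nat :=
  count (fun x => `[< label x.1 = a >]) s.

Definition continuously_enabled p v k : Prop :=
  (exists2 M, marking_at p k = Some M & enabled M v) /\
  forall i u, k < i -> trans_at p i = Some u ->
    mcap (pre v) (pre u) = mset0 (X := place N).

Definition act_enabled p a : Prop :=
  exists v k, label v = a /\ continuously_enabled p v k.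

Definition complete p : Prop :=
  is_path p /\ forall a, nonblocking a -> ~ act_enabled p a.

End Nets.

(* Main.v *)
Require Import Defs.

(** Fire nonblocking and [r_0] transitions fairly: as [r_1] never occurs, this
    gives an infinite path [us] with infinitely many [t_0] and no [t_1].
    Interleave [us] with a fair choice of nonblocking and [r_1] transitions
    sharing no input place with the rest of [us].  The outcome is complete and
    not [r_1]-enabled, so [r_1], hence [t_1], occurs on it.  Such a [t_1] is
    not from [us], so it can be postponed while [us] continues, until just
    after a [t_0], with no [e] in between. *)

Set Implicit Arguments.
Unset Strict Implicit.
Unset Printing Implicit Defensive.

(** * Fair scheduling of requests *)

(* A queue of pending requests: every step appends the requests raised by the
   current state and serves the head of the queue. *)
Lemma fair_schedule (X U : Type) (C : eqType) (c0 : C) (tasks : X -> seq C)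
    (R : X -> C -> U -> X -> Prop) (x0 : X) :
  (forall x c, exists uy : U * X, R x c uy.1 uy.2) ->
  exists (f : nat -> X) (us : nat -> U),
    [/\ f 0 = x0, forall n, exists c, R (f n) c (us n) (f n.+1)
      & forall k c, c \in tasks (f k) ->
          exists2 n, k <= n & R (f n) c (us n) (f n.+1)].
Proof.
move=> totR.
have [g gP] := choice (fun xc : X * C => totR xc.1 xc.2).
pose queue (st : X * seq C) := st.2 ++ tasks st.1.
(* [c0] is served whenever the queue is empty. *)
pose next st := g (st.1, head c0 (queue st)).
pose sts n := iter n (fun st => ((next st).2, behead (queue st))) (x0, [::]).
(* Each step drops the head and appends only at the end, so the request at position [i] is served
   exactly [i] steps later. *)
have served i : forall n, i < size (queue (sts n)) ->
  R (sts (n + i)).1 (nth c0 (queue (sts n)) i)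
    (next (sts (n + i))).1 (sts (n + i).+1).1.
  elim: i => [|i IHi] n ltin; first rewrite addn0 nth0.
    exact: (gP ((sts n).1, head c0 (queue (sts n)))).
  have ltin1 : i < size (behead (queue (sts n))).
    by rewrite size_behead; case: (size _) ltin.
  have -> : nth c0 (queue (sts n)) i.+1 = nth c0 (queue (sts n.+1)) i.
    by rewrite {2}/queue nth_cat ltin1 nth_behead.
  rewrite addnS -addSn; apply: IHi.
  by rewrite size_cat (leq_trans ltin1) ?leq_addr.
exists (fun n => (sts n).1), (fun n => (next (sts n)).1); split=> //.
  by move=> n; exists (head c0 (queue (sts n))); exact: (gP ((sts n).1, _)).
move=> k c ctask; have cq : c \in queue (sts k) by rewrite mem_cat ctask orbT.
exists (k + index c (queue (sts k))); first exact: leq_addr.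
by have := served _ k (etrans (index_mem _ _) cq); rewrite nth_index.
Qed.

(** * Firing sequences and the paths they trace *)

Lemma mcap0P (X : Type) (A B : mset X) :
  mcap A B = mset0 (X := X) <-> forall x, A x = 0 \/ B x = 0.
Proof.
split=> [eq0 x|eq0].
  have /eqP := congr1 (@^~ x) eq0; rewrite /mcap /mset0.
  by rewrite /minn; case: ifP => _ /eqP; [left|right].
apply: funext => x; rewrite /mcap.
by case: (eq0 x) => ->; rewrite (min0n, minn0).
Qed.

(** Total form of [fires], so that a sequence of transitions determines its markings; it is the
    firing rule only where [u] is enabled. *)
Definition fire (H O : Type) (N : petri H O) (M : mset (place N))
    (u : trans N) : mset (place N) := madd (msub M (pre u)) (post u).

Fixpoint after (H O : Type) (N : petri H O) (M : mset (place N))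
    (us : nat -> trans N) (n : nat) : mset (place N) :=
  if n is n'.+1 then fire (after M us n') (us n') else M.

Definition fireable (H O : Type) (N : petri H O) (M : mset (place N))
    (us : nat -> trans N) : Prop :=
  forall n, enabled (after M us n) (us n).

(** As paths count transitions from 1, [us n] sits at position [n.+1]. *)
Definition run (H O : Type) (N : petri H O) (us : nat -> trans N) : steps N :=
  Inf (fun n => (us n, after (init N) us n.+1)).

Definition path_to (H O : Type) (N : petri H O)
    (s : seq (trans N * mset (place N))) (M : mset (place N)) : Prop :=
  is_path (Fin s) /\ marking_at (Fin s) (size s) = Some M.

Lemma path_to_nil (H O : Type) (N : petri H O) :
  path_to (Nil (trans N * mset (place N))) (init N).
Proof. by split=> // k u M M' _; rewrite /= onth0n. Qed.

Lemma onth_size_rcons (T : Type) (s : seq T) x :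
  onth (rcons s x) (size s) = Some x.
Proof. by rewrite -cats1 onth_cat ltnn subnn. Qed.

Lemma onth_rcons_lt (T : Type) (s : seq T) x k :
  k < size s -> onth (rcons s x) k = onth s k.
Proof. by move=> ltk; rewrite -cats1 onth_cat ltk. Qed.

Lemma marking_at_rcons (H O : Type) (N : petri H O)
    (s : seq (trans N * mset (place N))) x k :
  k <= size s -> marking_at (Fin (rcons s x)) k = marking_at (Fin s) k.
Proof. by case: k => //= k ltk; rewrite onth_rcons_lt. Qed.

Lemma trans_at_rcons (H O : Type) (N : petri H O)
    (s : seq (trans N * mset (place N))) x k :
  size s = k -> trans_at (Fin (rcons s x)) k.+1 = Some x.1.
Proof. by move=> <-; rewrite /trans_at /step_at onth_size_rcons. Qed.

Lemma path_to_rcons (H O : Type) (N : petri H O) s (M : mset (place N)) u :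
  path_to s M -> enabled M u -> path_to (rcons s (u, fire M u)) (fire M u).
Proof.
case=> sP sM enu; split; last by rewrite size_rcons /= onth_size_rcons.
move=> k v M1 M2; case: (ltngtP k (size s)) => [ltk|gtk|->].
- rewrite !marking_at_rcons ?(ltnW ltk) //= onth_rcons_lt //; exact: sP.
- by move=> _ /=; rewrite onth_default // size_rcons.
- rewrite marking_at_rcons // sM /= onth_size_rcons /= => -[<-] [<-] [<-].
  by split.
Qed.

Lemma path_to_after (H O : Type) (N : petri H O) s (M : mset (place N)) us n :
  path_to s M -> fireable M us -> exists s', path_to s' (after M us n).
Proof.
move=> sM fus; elim: n => [|n [s' s'M]]; first by exists s.
by exists (rcons s' (us n, after M us n.+1)); apply: path_to_rcons.
Qed.

Lemma path_to_reachable (H O : Type) (N : petri H O) s (M : mset (place N)) :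
  path_to s M -> reachable M.
Proof. by case=> sP sM; exists (Fin s), (size s). Qed.

Lemma marking_at_run (H O : Type) (N : petri H O) (us : nat -> trans N) n :
  marking_at (run us) n = Some (after (init N) us n).
Proof. by case: n. Qed.

Lemma run_path (H O : Type) (N : petri H O) (us : nat -> trans N) :
  fireable (init N) us -> is_path (run us).
Proof.
move=> fus k u M M'; rewrite !marking_at_run /= => -[<-] [<-] [<-].
by split; first exact: fus.
Qed.

Lemma run_prefix (H O : Type) (N : petri H O) (us : nat -> trans N) n :
  fireable (init N) us ->
  path_to (mkseq (fun k => (us k, after (init N) us k.+1)) n)
    (after (init N) us n).
Proof.
move=> fus; elim: n => [|n IHn]; first exact: path_to_nil.
have -> : forall f : nat -> trans N * mset (place N),
    mkseq f n.+1 = rcons (mkseq f n) (f n).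
  by move=> f; rewrite /mkseq -{1}[n.+1]addn1 iotaD map_cat cats1.
exact: path_to_rcons.
Qed.

(** * Transitions sharing no input place *)

Lemma enabled_fire (H O : Type) (N : petri H O) (M : mset (place N)) u v :
  enabled M v -> mcap (pre v) (pre u) = mset0 (X := place N) ->
  enabled (fire M u) v.
Proof.
move=> env /mcap0P dis s; case: (dis s) => [->//|u0].
by rewrite /fire /madd /msub u0 subn0 (leq_trans (env s)) ?leq_addr.
Qed.

(** Where [v] takes tokens, [us] needs none; elsewhere firing [v] can only add tokens, and this
    surplus persists because firing is monotone in the marking. *)
Lemma fireable_fire (H O : Type) (N : petri H O) (M : mset (place N)) us v :
  fireable M us ->
  (forall n, mcap (pre v) (pre (us n)) = mset0 (X := place N)) ->
  fireable (fire M v) us.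
Proof.
move=> fus dis n s.
have [v0|us0] := (mcap0P _ _).1 (dis n) s; last by rewrite us0.
suff: after M us n s <= after (fire M v) us n s.
  by apply: leq_trans; apply: fus.
elim: n => [|n IHn] /=; first by rewrite /fire /madd /msub v0 subn0 leq_addr.
by rewrite /fire /madd /msub leq_add2r leq_sub2r.
Qed.

Lemma continuously_enabledW (H O : Type) (N : petri H O) (p : steps N) v k n M :
  is_path p -> continuously_enabled p v k -> k <= n ->
  marking_at p n = Some M -> enabled M v.
Proof.
move=> pP [[M0 M0k env] dis].
elim: n M => [|n IHn] M.
  by rewrite leqn0 => /eqP k0; move: M0k; rewrite k0 => -> [<-].
rewrite leq_eqVlt => /predU1P[k1|ltkn].
  by move: M0k; rewrite k1 => -> [<-].
move=> Mn.
(* A marking at [n.+1] presupposes one at [n] and a transition between them. *)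
have [M1 M1n] : exists M1, marking_at p n = Some M1.
  case: n {IHn ltkn} Mn => [_|n]; first by exists (init N).
  rewrite /marking_at; case: (p) => [s|f]; rewrite /step_at => Mn.
    2: by exists (f n).2.
  have : n < size s by apply: ltnW; rewrite -onthTE; case: (onth s n.+1) Mn.
  by rewrite -onthTE; case: (onth s n) => // x _; exists x.2.
have [u un] : exists u, trans_at p n.+1 = Some u.
  by move: Mn => /=; case: (step_at p n) => // x _; exists x.1.
have [_ ->] := pP _ _ _ _ M1n un Mn.
by apply: enabled_fire; [apply: IHn M1n | apply: dis un].
Qed.

(** * Fair infinite runs *)

(* The default transition [D] is fired infinitely often, while no transition
   stays schedulable by [S] forever without losing an input token: the requests
   served are the marked places, [None] standing for a default step. *)
Lemma fair_run (H O : Type) (N : petri H O) (X : Type)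
    (mk : X -> mset (place N)) (D S : X -> trans N -> X -> Prop)
    (P : X -> Prop) (x0 : X) :
  is_net N -> mk x0 = init N -> P x0 ->
  (forall x u y, P x -> D x u y \/ S x u y ->
     [/\ P y, enabled (mk x) u & mk y = fire (mk x) u]) ->
  (forall x, P x -> exists u y, D x u y) ->
  exists (f : nat -> X) (us : nat -> trans N),
    [/\ fireable (init N) us,
        forall n, P (f n) /\ mk (f n) = after (init N) us n,
        f 0 = x0,
        (forall n, D (f n) (us n) (f n.+1) \/ S (f n) (us n) (f n.+1)) /\
        (forall k, exists2 n, k <= n & D (f n) (us n) (f n.+1))
      & forall v k, ~ forall n, k <= n ->
          (enabled (mk (f n)) v /\ exists y, S (f n) v y) /\
          mcap (pre v) (pre (us n)) = mset0 (X := place N)].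
Proof.
move=> [_ preN0 finN] mk0 P0 PS totD.
(* For an infinite marking, which is never reached, any list will do. *)
have /choice[supp suppP] : forall x, exists l : seq {classic (place N)},
    mfinite (mk x) -> forall s : place N, 0 < mk x s -> (s : {classic _}) \in l.
  move=> x; have [fin|nfin] := pselect (mfinite (mk x)); last by exists [::].
  have /(@finite_seqP {classic (place N)})[l lE] := fin.
  by exists l => _ s s0; have : [set` l]%classic s by rewrite -lE.
pose tasks x : seq (option {classic (place N)}) := None :: map Some (supp x).
pose hit x s := exists u y, S x u y /\ 0 < pre u s.
(* A request for [s] is met by a schedulable step consuming from [s] or, if there is none, by a
   default step. The guard [P x] makes [R] total, as [fair_schedule] demands. *)
pose R x (c : option {classic (place N)}) u y := P x ->
  if c is Some s then (S x u y /\ 0 < pre u s) \/ (D x u y /\ ~ hit x s)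
  else D x u y.
have [f [us [f0 step served]]] : exists f us,
    [/\ f 0 = x0, forall n, exists c, R (f n) c (us n) (f n.+1)
      & forall k c, c \in tasks (f k) ->
          exists2 n, k <= n & R (f n) c (us n) (f n.+1)].
  apply: (@fair_schedule X _ _ None) => x c.
  have [Px|nPx] := pselect (P x).
    2: by have [u [y _]] := totD _ P0; exists (u, y).
  have [u [y Duy]] := totD _ Px.
  case: c => [s|]; last by exists (u, y).
  have [hs|nhs] := pselect (hit x s); last by exists (u, y) => _; right.
  by have [u' [y' ?]] := hs; exists (u', y') => _; left.
have DS n : P (f n) -> D (f n) (us n) (f n.+1) \/ S (f n) (us n) (f n.+1).
  move=> Pn; have [[s|] /(_ Pn)] := step n; last by left.
  by case=> [[Sn _]|[Dn _]]; [right|left].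
have Pf n : P (f n) /\ mk (f n) = after (init N) us n.
  elim: n => [|n [Pn mkn]]; first by rewrite f0.
  by have [Pn1 _ mkn1] := PS _ _ _ Pn (DS n Pn); rewrite /= -mkn.
have fus : fireable (init N) us.
  by move=> n; have [Pn <-] := Pf n; have [] := PS _ _ _ Pn (DS n Pn).
exists f, us; split=> //.
  split=> [n|k]; first by apply: DS; have [] := Pf n.
  have [|n kn Rn] := served k None; first by rewrite mem_head.
  by exists n => //; apply: Rn; have [] := Pf n.
move=> v k vk.
(* An input place [s] of [v] is marked at [k], so its request is served at some [n >= k]. As [v]
   itself can be scheduled then, the step served consumes from [s], against disjointness. *)
have [s vs] : exists s, 0 < pre v s.
  apply: contrapT => nvs; apply: (preN0 v); apply: funext => s.
  by apply/eqP; rewrite -leqn0 leqNgt; apply/negP => s0; apply: nvs; exists s.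
have [[env _] _] := vk k (leqnn k).
have [|n kn] := served k (Some s).
  rewrite inE /=; apply: map_f; apply: suppP (leq_trans vs (env s)).
  apply: finN; have [_ ->] := Pf k.
  exact: path_to_reachable (run_prefix k fus).
have [[env' [y Sy]] /mcap0P /(_ s) dis] := vk n kn.
case/(_ (Pf n).1) => [[_ us0]|[_ []]]; last by exists v, y.
by case: dis => E; move: vs us0; rewrite E.
Qed.

(** * Enabledness and occurrences along runs *)

Lemma enabled_after (H O : Type) (N : petri H O) (M : mset (place N)) us v n :
  enabled M v ->
  (forall k, mcap (pre v) (pre (us k)) = mset0 (X := place N)) ->
  enabled (after M us n) v.
Proof. by move=> env dis; elim: n => //= n IHn; apply: enabled_fire. Qed.

Lemma after_fire (H O : Type) (N : petri H O) (M : mset (place N)) us n :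
  after (fire M (us 0)) (fun k => us k.+1) n = after M us n.+1.
Proof. by elim: n => //= n ->. Qed.

Lemma act_enabled_run (H O : Type) (N : petri H O) (us : nat -> trans N) a :
  fireable (init N) us -> act_enabled (run us) a ->
  exists v k, label v = a /\ forall n, k <= n ->
    enabled (after (init N) us n) v /\
    mcap (pre v) (pre (us n)) = mset0 (X := place N).
Proof.
move=> fus [v [k [va cev]]]; exists v, k; split=> // n kn; split.
  exact: continuously_enabledW (run_path fus) cev kn (marking_at_run us n).
by have [_ /(_ n.+1 (us n))] := cev; apply.
Qed.

Lemma run_often (H O : Type) (N : petri H O) (us : nat -> trans N) a :
  infinite_set (occurrences (run us) a) ->
  forall k, exists2 n, k <= n & label (us n) = a.
Proof.
move=> inf k; apply: contrapT => nex; apply: inf.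
apply: (sub_finite_set _ (finite_II k.+1)) => -[|n] [u //= [<-] una].
by rewrite ltnS ltnNge; apply/negP => kn; apply: nex; exists n; rewrite ?una.
Qed.

Lemma count_occ_run (H O : Type) (N : petri H O) (us : nat -> trans N) a n :
  0 < count_occ (mkseq (fun k => (us k, after (init N) us k.+1)) n) a <->
  exists2 k, k < n & label (us k) = a.
Proof.
rewrite -has_count has_map; split=> [/hasP[k]|[k kn ka]].
  by rewrite mem_iota => kn /asboolP; exists k.
by apply/hasP; exists k; rewrite ?mem_iota //=; apply/asboolP.
Qed.

(** * The base run and its interleaving *)

(* The fair scheduling cannot get stuck: a deadlock would be a complete path
   with finitely many [h] on which [h] is not enabled. *)
Lemma request_run (H O : Type) (N : petri H O) (h : H) :
  is_net N ->
  (forall p : steps N, complete p -> finite_set (occurrences p (Handshake h)) ->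
     act_enabled p (Handshake h)) ->
  exists us : nat -> trans N,
    [/\ fireable (init N) us, complete (run us),
        forall n, nonblocking (label (us n)) \/ label (us n) = Handshake h
      & forall k, exists2 n, k <= n & label (us n) = Handshake h].
Proof.
move=> netN reqN; pose A (a : act H O) := nonblocking a \/ a = Handshake h.
pose D M (u : trans N) M' := [/\ A (label u), enabled M u & M' = fire M u].
pose P (M : mset (place N)) := exists s, path_to s M.
have totD M : P M -> exists u M', D M u M'.
  move=> [s [sP sM]]; apply: contrapT => nD.
  (* A continuously enabled transition is still enabled at the last marking, where [nD] forbids
     it. *)
  have nA a : A a -> ~ act_enabled (Fin s) a.
    move=> Aa [v [k [va cev]]]; apply: nD; exists v, (fire M v).
    split; rewrite ?va //; apply: (continuously_enabledW sP cev _ sM).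
    case: cev => [[M0 M0k _] _]; case: k M0k => //= k.
    by rewrite -onthTE; case: (onth s k).
  apply: (nA (Handshake h)); first by right.
  apply: reqN; first by split=> // a nba; apply: nA; left.
  apply: (sub_finite_set _ (finite_II (size s).+1)) => -[|k] [u //=].
  by rewrite ltnS -onthTE; case: (onth s k).
(* States are the markings themselves, and [D] is both the default and the scheduled step. *)
have [|M u M' [s sM]||f [us [fus fP _ [DD _] fair]]] :=
  @fair_run _ _ N _ id D D P (init N) netN erefl.
- by exists [::]; apply: path_to_nil.
- case=> -[_ enu ->]; split=> //;
    by exists (rcons s (u, fire M u)); apply: path_to_rcons.
- exact: totD.
have nA a : A a -> ~ act_enabled (run us) a.
  move=> Aa /(act_enabled_run fus)[v [k [va vk]]]; apply: (fair v k) => n kn.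
  have [env dis] := vk n kn; have [_ fE] := fP n; split=> //.
  rewrite /= fE; split=> //; exists (fire (after (init N) us n) v).
  by split; rewrite ?va.
have cus : complete (run us).
  by split; [apply: run_path | move=> a nba; apply: nA; left].
exists us; split=> // [n|]; first by case: (DD n) => -[].
by apply: run_often => fin; apply: (nA (Handshake h)); [right | apply: reqN].
Qed.

(** A state pairs the marking with the number of steps of [us] made so far. Default steps follow
    [us]; scheduled ones avoid the input places of its remainder, which therefore stays fireable. *)
Lemma interleaved_run (H O : Type) (N : petri H O) (us : nat -> trans N)
    (A : act H O -> Prop) :
  is_net N -> fireable (init N) us ->
  exists ws : nat -> trans N,
    [/\ fireable (init N) ws, forall a, A a -> ~ act_enabled (run ws) a
      & forall n, (exists j, ws n = us j) \/
          exists j, fireable (after (init N) ws n) (fun i => us (j + i)) /\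
            forall i, mcap (pre (ws n)) (pre (us (j + i))) =
                        mset0 (X := place N)].
Proof.
move=> netN fus.
pose D (x : mset (place N) * nat) u y := u = us x.2 /\ y = (fire x.1 u, x.2.+1).
pose free (x : mset (place N) * nat) u :=
  forall i, mcap (pre u) (pre (us (x.2 + i))) = mset0 (X := place N).
pose S (x : mset (place N) * nat) u y :=
  [/\ A (label u), enabled x.1 u, free x u & y = (fire x.1 u, x.2)].
pose P (x : mset (place N) * nat) := fireable x.1 (fun i => us (x.2 + i)).
have [|x u y Px||f [ws [fws fP f0 [DS infD] fair]]] :=
  @fair_run _ _ N _ fst D S P (init N, 0) netN erefl.
- exact: fus.
- case=> [[-> ->]|[_ enu dis ->]]; split=> //=.
  + move=> n /=; have := Px n.+1; rewrite -after_fire addn0.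
    by rewrite -addSnnS; under [X in after _ X]funext => k do rewrite -addSnnS.
  + by have := Px 0; rewrite addn0.
  + exact: fireable_fire.
- by move=> x _; exists (us x.2), (fire x.1 (us x.2), x.2.+1).
(* Scheduled steps before the next default step leave the counter unchanged. *)
have nextD n : exists2 m, n <= m & (f m).2 = (f n).2 /\ D (f m) (ws m) (f m.+1).
  have [m nm] := infD n; rewrite -(subnKC nm).
  move: (m - n) => d; elim: d n {nm} => [|d IHd] n.
    by rewrite addn0; exists n.
  case: (DS n) => [Dn _|[_ _ _ fn1]]; first by exists n.
  rewrite -addSnnS => /IHd[k nk [fk Dk]]; exists k; first exact: ltnW.
  by rewrite fk fn1.
have base_later i : forall n, exists2 m, n <= m & ws m = us ((f n).2 + i).
  elim: i => [|i IHi] n; have [m nm [fm [wsm fm1]]] := nextD n.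
    by exists m; rewrite // wsm fm addn0.
  have [k mk wsk] := IHi m.+1; exists k; first exact: leq_trans nm (ltnW mk).
  by rewrite wsk fm1 /= fm addSnnS.
(* All of the remaining [us] still occurs on [ws], so a transition continuously enabled on [ws]
   shares no input place with it. It thus stays schedulable, which fairness excludes. *)
exists ws; split=> // [a Aa /(act_enabled_run fws)[v [k [va vk]]]|n].
  apply: (fair v k) => n kn; have [env dis] := vk n kn; split=> //.
  have [_ ->] := fP n; split=> //; exists (fire (f n).1 v, (f n).2).
  split; rewrite ?va //; first by have [_ ->] := fP n.
  move=> i; have [m nm <-] := base_later i n.
  by have [] := vk m (leq_trans kn nm).
case: (DS n) => [[-> _]|[_ _ dis _]]; first by left; exists (f n).2.
by right; exists (f n).2; split=> //; have [Pn <-] := fP n.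
Qed.

(** * The contradiction *)

Theorem theorem3 (H O : Type) (r : 'I_2 -> H) (t : 'I_2 -> O) (e : O)
    (r_distinct : injective r) (t_distinct : injective t)
    (e_distinct : forall i : 'I_2, e <> t i) :
  ~ exists N : petri H O,
      is_net N /\
      (forall i : 'I_2,
         [/\ forall p : steps N, complete p ->
               finite_set (occurrences p (Handshake (r i))) ->
               act_enabled p (Handshake (r i)),
             forall p : steps N, complete p ->
               forall k : nat, occurs_at p (Handshake (r i)) k ->
               exists2 l : nat, k < l & occurs_at p (Output (t i)) l
           & forall s : seq (trans N * mset (place N)), is_path (Fin s) ->
               count_occ s (Output (t i)) <= count_occ s (Handshake (r i))]) /\
      (forall p : steps N, is_path p ->
         forall (i j : 'I_2) (k l : nat), k < l ->
           occurs_at p (Output (t i)) k -> occurs_at p (Output (t j)) l ->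
           exists2 m : nat, k < m < l & occurs_at p (Output e) m).
Proof.
move=> [N [netN [spec sepN]]].
have [req0 ans0 _] := spec ord0; have [req1 ans1 le1] := spec ord_max.
have [us [fus cus usA us_r0]] := request_run netN req0.
have us_t0 k : exists2 n, k <= n & label (us n) = Output (t ord0).
  have [n kn nr] := us_r0 k.
  have [|[//|l] nl [u [<-] lt0]] := ans0 _ cus n.+1; first by exists (us n).
  by exists l => //; rewrite (leq_trans kn) // ltnW.
(* Such an answer would need an earlier [r ord_max] on [us], whose labels are nonblocking or
   [r ord0]. *)
have us_t1 n : label (us n) <> Output (t ord_max).
  move=> nt; have [] := run_prefix n.+1 fus => /le1 + _.
  have /(count_occ_run us _ n.+1) :
      exists2 k, k < n.+1 & label (us k) = Output (t ord_max).
    by exists n.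
  move=> /leq_trans/[apply]/(count_occ_run us)[k _ kr].
  by have := usA k; rewrite kr => -[//|[/r_distinct]].
pose A (a : act H O) := nonblocking a \/ a = Handshake (r ord_max).
have [ws [fws nA wsP]] := interleaved_run A netN fus.
have cws : complete (run ws).
  by split; [apply: run_path | move=> a nba; apply: nA; left].
have [n _ nr] : exists2 n, 0 <= n & label (ws n) = Handshake (r ord_max).
  apply: run_often => fin.
  by apply: (nA (Handshake (r ord_max))); [right | apply: req1].
have [|[//|l] _ [w [<-] lt1]] := ans1 _ cws n.+1; first by exists (ws n).
(* The answer [ws l] is not from [us], so it shares no input place with [us] from [j] on and stays
   enabled while that part fires. *)
have [[j wsj]|[j [fj dis]]] := wsP l; first by apply: (us_t1 j); rewrite -wsj.
have [m jm mt0] := us_t0 j; pose vs i := us (j + i).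
(* Delay the answer to the second request until just after an answer to the
   first one. *)
have [s sM] := path_to_after (m - j) (run_prefix l fws) fj.
have sM' := path_to_rcons sM (fj (m - j)).
have [sP _] := path_to_rcons sM' (enabled_after (m - j).+1 (fws l) dis).
(* [us m] and [ws l] are the last two transitions of the path, so no position between them is left
   for [e]. *)
have [||k] := sepN _ sP ord0 ord_max (size s).+1 (size s).+2 (leqnn _).
- exists (us m) => //=; rewrite onth_rcons_lt ?size_rcons // onth_size_rcons /=.
  by rewrite subnKC.
- by exists (ws l) => //; rewrite trans_at_rcons ?size_rcons.
- by case/andP=> /leq_trans/[apply]; rewrite ltnn.
Qed.
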